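(* Let $n \geq 1$ and let $H$ be a regular graph (possibly with loops). For an integer $\ell \geq 1$, let $H^{\circ}(\ell)$ be the join of $H$ and $K_{\ell}^{\circ}$. Then for every tree $T$ on $n$ vertices, $$\hom(P_n, H^{\circ}(\ell)) \leq \hom(T, H^{\circ}(\ell)).$$ Equality occurs if and only if $T = P_n$ or $H^{\circ}(\ell) = K_q^{\circ}$ for some $q \geq \ell$ (equalities of graphs being up to isomorphism).
   Context: All graphs are finite. Trees are simple and loopless; the target graph $H$ may have loops but has no multiple edges. For a simple loopless graph $G$ and a graph $H$, an $H$-coloring of $G$ is a map $f: V(G) \to V(H)$ such that $f(x)$ and $f(y)$ are adjacent in $H$ whenever $x$ and $y$ are adjacent in $G$; $\hom(G,H)$ is the number of $H$-colorings of $G$. The degree of a vertex $v$ is $d(v) = |\{w : v \sim w\}|$, so a loop at $v$ adds exactly one to its degree; a graph is regular if all its vertices have the same degree in this sense. $P_n$ is the path on $n$ vertices. $K_m$ is the complete graph on $m$ vertices, and $K_m^{\circ}$ is obtained from $K_m$ by adding a loop at every vertex. The join of two graphs is their disjoint union together with all edges between a vertex of the first and a vertex of the second. *)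

(* Defs.v *)
From mathcomp Require Import all_boot.

Set Implicit Arguments.
Unset Strict Implicit.
Unset Printing Implicit Defensive.

(* Finite graphs without multiple edges; a loop at x is [adj x x]. The vertex
   set may be empty. *)
Record graph := Graph {
  vertex :> finType;
  adj : rel vertex;
  adj_sym : symmetric adj }.

Definition loopless (G : graph) : Prop := irreflexive (@adj G).

Definition connected_graph (G : graph) : Prop :=
  0 < #|G| /\ forall x y : G, connect (@adj G) x y.

(* [ucycle] also accepts an edge traversed back and forth (size 2), the empty
   sequence and a loop (size 1); genuine cycles of a loopless graph have at
   least 3 vertices. *)
Definition acyclic (G : graph) : Prop :=
  forall c : seq G, ucycle (@adj G) c -> size c <= 2.

Definition is_tree (G : graph) : Prop :=
  [/\ loopless G, connected_graph G & acyclic G].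

(* A loop at v contributes exactly one to the degree of v. *)
Definition degree (G : graph) (v : G) : nat := #|[set w : G | adj v w]|.

Definition regular (G : graph) : Prop :=
  exists d : nat, forall v : G, degree v = d.

Definition graph_iso (G1 G2 : graph) : Prop :=
  exists2 f : G1 -> G2, bijective f & forall x y, adj (f x) (f y) = adj x y.

Definition is_coloring (G H : graph) (f : G -> H) : bool :=
  [forall x, forall y, adj x y ==> adj (f x) (f y)].

Definition hom (G H : graph) : nat :=
  #|[set f : {ffun G -> H} | is_coloring f]|.

Section PathGraph.
Variable n : nat.

Definition path_adj : rel 'I_n := fun i j => (i.+1 == j) || (j.+1 == i).

Lemma path_adj_sym : symmetric path_adj.
Proof. by move=> i j; rewrite /path_adj orbC. Qed.

Definition path_graph : graph := Graph path_adj_sym.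
End PathGraph.

Section LoopedComplete.
Variable m : nat.

Definition looped_complete_adj : rel 'I_m := fun _ _ => true.

Lemma looped_complete_adj_sym : symmetric looped_complete_adj.
Proof. by []. Qed.

Definition looped_complete : graph := Graph looped_complete_adj_sym.
End LoopedComplete.

Section Join.
Variables G1 G2 : graph.

Definition join_adj : rel (G1 + G2) := fun u v =>
  match u, v with
  | inl x, inl y => adj x y
  | inr x, inr y => adj x y
  | _, _ => true
  end.

Lemma join_adj_sym : symmetric join_adj.
Proof. by move=> [x|x] [y|y] //=; rewrite adj_sym. Qed.

Definition join : graph := Graph join_adj_sym.
End Join.

Definition looped_join (H : graph) (l : nat) : graph :=
  join H (looped_complete l).

(* Main.v *)
Require Import Defs.
From mathcomp Require Import all_boot zify.

Set Implicit Arguments.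
Unset Strict Implicit.
Unset Printing Implicit Defensive.

(** In the target graph J every vertex is either dominating (adjacent to all
    vertices, itself included) or of one fixed degree a, and this is all that
    the argument uses of the join of a regular graph with a looped complete
    graph. Write N for the number of vertices of J and B for its nonempty set of
    dominating vertices. If B is everything, each map is a coloring and all
    graphs with n vertices have N ^ n of them. Otherwise #|B| <= a < N, and the
    argument of Prodinger and Tichy for independent sets carries over. Let x be
    a leaf of a forest F with neighbor y. A coloring of F - x extends to x in N
    ways if y has a color in B and in a ways otherwise; a coloring of F - x - y
    extends to y with a color in B in exactly #|B| ways, because such a color
    conflicts with nothing. Hence ([card_colorings_leaf])
      hom F = a hom (F - x) + (N - a) #|B| hom (F - x - y).
    Paths satisfy this recursion ([card_colorings_line]). Since F - x and
    F - x - y are again forests, induction over forests, rather than over trees,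
    gives the inequality at once. The other case of the induction is that of an
    isolated vertex, which multiplies the number by N, whereas one more vertex
    multiplies that of a nonempty path by less ([path_count_isolated]).

    Both coefficients are positive, so equality forces F - x and F - x - y to be
    paths. As the path F - x - y is connected, y is an end of the path F - x
    ([line_delete_end]), and F is a path ([forest_lower_bound]).

    The subforests are subsets S of the vertex set of a single graph, so that
    acyclicity never has to be transported between graphs. *)

(** * Acyclic graphs have leaves *)

Section Leaf.
Variable G : graph.

(** Otherwise a simple path inside S could be extended at its head forever: the
    head has a neighbor other than the next vertex of the path, and a neighbor
    further down the path would close a cycle. *)
Lemma acyclic_leaf (S : {set G}) : loopless G -> acyclic G -> S != set0 ->
  exists2 x, x \in S & #|[set z in S | adj x z]| <= 1.
Proof.
move=> loG acG /set0Pn[v vS].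
case: (pickP (fun x => (x \in S) && (#|[set z in S | adj x z]| <= 1))).
  by move=> x /andP[xS xle]; exists x.
move=> nleaf; exfalso.
have long n : exists x p, [/\ size p = n, path (@adj G) x p, uniq (x :: p)
                            & {subset x :: p <= S}].
  elim: n => [|n [x [p [szp pp up sp]]]].
    by exists v, [::]; split=> // z; rewrite inE => /eqP->.
  have xS : x \in S by apply: sp; rewrite mem_head.
  have deg2 : 1 < #|[set z in S | adj x z]|.
    by move: (nleaf x); rewrite xS /= ltnNge => ->.
  have [z zS znh] : exists2 z, z \in [set z in S | adj x z] &
      forall y p', p = y :: p' -> z != y.
    move: deg2; rewrite (cardsD1 (head x p)) => deg2.
    have /card_gt0P[z] : 0 < #|[set z in S | adj x z] :\ head x p|.
      by case: (_ \in _) deg2 => /=; rewrite ?add0n ?add1n // => /ltnW.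
    rewrite in_setD1 => /andP[zh zS]; exists z => // y p' pE.
    by rewrite pE in zh.
  move: zS; rewrite inE => /andP[zS exz].
  exists z, (x :: p); split=> /=.
  - by rewrite szp.
  - by rewrite adj_sym exz.
  - rewrite -/(uniq (x :: p)) up andbT inE negb_or.
    have -> : z != x by apply: contraTneq exz => ->; rewrite loG.
    apply/negP=> zp; move: pp up znh; case/splitPr: zp => p1 p2 pp up znh.
    have p1N : 0 < size p1.
      case: p1 pp up znh => //= _ _ znh.
      by have := znh _ _ erefl; rewrite eqxx.
    have /acG : ucycle (@adj G) (x :: rcons p1 z).
      rewrite /ucycle /cycle.
      move: pp up; rewrite -cat_rcons cat_path => /andP[pp _].
      rewrite -cat_cons cat_uniq => /and3P[up _ _].
      by rewrite up andbT rcons_path pp last_rcons adj_sym exz.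
    by rewrite /= size_rcons !ltnS leqNgt p1N.
  - by move=> w; rewrite inE => /predU1P[->|/sp].
have [x [p [szp _ up _]]] := long #|G|.
by have := max_card [in x :: p]; rewrite (card_uniqP up) /= szp ltnn.
Qed.
End Leaf.

(** * Induced paths *)

Section Line.
Variable G : graph.

(** An induced path, listed from end to end. Adjacency is read off the positions
    in s because positions behave well under reversal and give the isomorphism
    with the path graph directly. *)
Definition line (s : seq G) : Prop :=
  uniq s /\ {in s &, forall x y, adj x y =
    ((index x s).+1 == index y s) || ((index y s).+1 == index x s)}.

Lemma line_behead x s : line (x :: s) -> line s.
Proof.
case=> /= /andP[xs us] sl; split=> // y z ys zs.
have xy : x == y = false by apply: contraNF xs => /eqP->.
have xz : x == z = false by apply: contraNF xs => /eqP->.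
by have := sl y z; rewrite /= xy xz !inE ys zs !orbT !eqSS => ->.
Qed.

Lemma line_head x s : line (x :: s) ->
  [set z in s | adj x z] = if s is y :: _ then [set y] else set0.
Proof.
case=> /= /andP[xs us] sl; apply/setP=> z; rewrite inE.
have [zs|zs] := boolP (z \in s); last first.
  by case: s zs {xs us sl} => [|y s]; rewrite !inE // negb_or => /andP[/negPf->].
have xz : x == z = false by apply: contraNF xs => /eqP->.
have := sl x z; rewrite /= eqxx xz !inE zs eqxx orbT => /(_ isT isT)->.
case: s zs {xs us sl} => [//|y s] /= _; rewrite !inE orbF eqSS.
by rewrite [z == y]eq_sym; case: (y == z).
Qed.

Lemma line1 x : loopless G -> line [:: x].
Proof.
by move=> loG; split=> // y z; rewrite !inE => /eqP-> /eqP->; rewrite loG /= eqxx.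
Qed.

Lemma line_cons x y s : loopless G -> line (y :: s) -> x \notin y :: s ->
  {in y :: s, forall z, adj x z = (z == y)} -> line [:: x, y & s].
Proof.
move=> loG [us sl] xs xl; split; first by rewrite cons_uniq xs.
have xN z : z \in y :: s -> x == z = false.
  by move=> zs; apply: contraNF xs => /eqP->.
have xE z : z \in y :: s -> (index z (y :: s) == 0) = (z == y).
  by move=> zs /=; rewrite [z == y]eq_sym; case: (y == z).
have indexS z : index z [:: x, y & s] = if x == z then 0 else (index z (y :: s)).+1.
  by [].
move=> u v /predU1P[->|us'] /predU1P[->|vs'].
- by rewrite loG /= eqxx.
- by rewrite !indexS eqxx xN // eqSS eq_sym orbF xE ?xl.
- by rewrite adj_sym !indexS eqxx xN // eqSS [0 == _]eq_sym xE ?xl.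
by rewrite !indexS !xN // !eqSS sl.
Qed.

Lemma index_rev_uniq (s : seq G) x : uniq s -> x \in s ->
  index x (rev s) = size s - (index x s).+1.
Proof.
move=> us xs; have ltx : index x s < size s by rewrite index_mem.
have lt : size s - (index x s).+1 < size s by rewrite ltn_subrL (leq_trans _ ltx).
have {1}<- : nth x (rev s) (size s - (index x s).+1) = x.
  by rewrite nth_rev // subnSK // subKn ?nth_index // ltnW.
by rewrite index_uniq ?size_rev ?rev_uniq.
Qed.

Lemma line_rev s : line s -> line (rev s).
Proof.
case=> us sl; split=> [|x y]; first by rewrite rev_uniq.
rewrite !mem_rev => xs ys; rewrite sl // !index_rev_uniq //.
have := index_mem x s; have := index_mem y s; rewrite xs ys.
by move: (index x s) (index y s) => i j; move: (size s) => k; lia.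
Qed.

(** If y were interior to s, no edge would join the part of s before y to the
    part after it, whereas the line t, made of both parts, is connected. *)
Lemma line_delete_end s t y : line s -> line t -> y \in s ->
  t =i [predD1 s & y] -> index y s = 0 \/ (index y s).+1 = size s.
Proof.
move=> [us sl] [ut tl] ys ts.
case: (posnP (index y s)) => [|y0]; first by left.
have := ys; rewrite -index_mem leq_eqVlt => /predU1P[|yl]; first by right.
exfalso; pose before z := index z s < index y s.
have tP z : z \in t -> z \in s /\ index z s != index y s.
  rewrite ts !inE => /andP[zy zs]; split=> //.
  by apply: contraNneq zy => /(index_inj z zs ys)->.
have step u v : u \in t -> v \in t -> adj u v -> before v = before u.
  move=> /tP[us' un] /tP[vs' vn]; rewrite sl // /before.
  by move: (index y s) (index u s) (index v s) un vn => a b c; lia.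
have all_before j : j < size t -> before (nth y t j) = before (nth y t 0).
  elim: j => // j IHj jt; have jt' := ltnW jt.
  rewrite -IHj //; apply: step; rewrite ?mem_nth //.
  by rewrite tl ?mem_nth // !index_uniq // eqxx.
have in_t i : i < size s -> i != index y s ->
    before (nth y s i) = before (nth y t 0).
  move=> li ni; have it : nth y s i \in t.
    rewrite ts !inE mem_nth // andbT; apply: contraNneq ni => yi.
    by have := index_uniq y li us; rewrite yi => ->.
  by rewrite -(nth_index y it) all_before // index_mem.
have s0 : 0 < size s by apply: leq_ltn_trans yl.
have := in_t _ s0; rewrite neq_ltn y0 -(in_t _ yl) ?neq_ltn ?ltnSn ?orbT //.
by rewrite /before !index_uniq // y0 => /(_ isT)/esym; rewrite ltnNge leqnSn.
Qed.

Lemma line_path_iso s : line s -> [set z in s] = [set: G] ->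
  graph_iso G (path_graph #|G|).
Proof.
move=> [us sl] sT; have allS x : x \in s by have := in_setT x; rewrite -sT inE.
have szs : size s = #|G|.
  by rewrite -(card_uniqP us); apply: eq_card => x; rewrite allS.
have lt x : index x s < #|G| by rewrite -szs index_mem.
exists (fun x => Ordinal (lt x) : path_graph #|G|).
  apply: inj_card_bij; last by rewrite card_ord.
  by move=> x y [] /(index_inj x (allS x) (allS y)).
by move=> x y; rewrite sl.
Qed.
End Line.

Lemma path_graph_line n : line (enum 'I_n : seq (path_graph n)).
Proof.
have indexE (i : path_graph n) : index i (enum 'I_n : seq (path_graph n)) = i :> nat.
  exact: index_enum_ord.
split=> [|i j _ _]; first exact: enum_uniq.
by rewrite !indexE.
Qed.

Lemma iso_path_line (G : graph) n : graph_iso G (path_graph n) ->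
  exists2 s : seq G, line s & [set z in s] = [set: G].
Proof.
case=> f [g fK gK] fadj; have [us sl] := path_graph_line n.
have g_inj := can_inj gK.
exists (map g (enum 'I_n)); last first.
  by apply/setP=> x; rewrite !inE -[x]fK map_f ?mem_enum.
split=> [|x y _ _]; first by rewrite map_inj_uniq.
by rewrite -fadj -[x in RHS]fK -[y in RHS]fK !(index_map g_inj) sl ?mem_enum.
Qed.

(** * Colorings of induced subgraphs *)

Section Colorings.
Variables (G J : graph) (j0 : J).

(** Colorings of the subgraph induced by S, extended by the constant j0 outside
    S so that each is counted once. *)
Definition colorings (S : {set G}) : {set {ffun G -> J}} :=
  [set f : {ffun G -> J} | [forall x in S, forall y in S, adj x y ==> adj (f x) (f y)]
           && [forall x, (x \notin S) ==> (f x == j0)]].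

Lemma coloringsP (S : {set G}) (f : {ffun G -> J}) :
  reflect ({in S &, forall x y, adj x y -> adj (f x) (f y)} /\
           forall x, x \notin S -> f x = j0)
          (f \in colorings S).
Proof.
rewrite inE; apply: (iffP andP) => [] [fS f0]; split.
- by move=> x y xS yS; move/forall_inP/(_ _ xS)/forall_inP/(_ _ yS)/implyP: fS.
- by move=> x xS; apply/eqP; move/forallP/(_ x)/implyP: f0; apply.
- apply/forall_inP=> x xS; apply/forall_inP=> y yS; apply/implyP; exact: fS.
- by apply/forallP=> x; apply/implyP=> /f0->.
Qed.

Lemma hom_colorings : hom G J = #|colorings [set: G]|.
Proof.
apply: eq_card => f; rewrite inE; apply/idP/coloringsP.
  move=> /forallP fP; split=> [x y _ _|x]; last by rewrite inE.
  by move/forallP/(_ y)/implyP: (fP x).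
by case=> fP _; apply/forallP=> x; apply/forallP=> y; apply/implyP/fP; rewrite inE.
Qed.

Lemma card_colorings0 : #|colorings set0| = 1.
Proof.
apply/eqP/cards1P; exists [ffun=> j0]; apply/setP=> f; rewrite inE.
apply/coloringsP/eqP=> [[_ f0]|->].
  by apply/ffunP=> x; rewrite ffunE f0 ?inE.
by split=> x; rewrite ?inE ?ffunE.
Qed.

Definition recolor (f : {ffun G -> J}) (x : G) (c : J) : {ffun G -> J} :=
  [ffun z => if z == x then c else f z].

Definition compatible (S : {set G}) (g : {ffun G -> J}) (x : G) (c : J) :=
  [forall z in S, adj x z ==> adj c (g z)].

(** A coloring of S with x added amounts to a coloring of S together with a
    compatible color for x. The weight phi lets one lemma serve both for
    counting colorings and for counting those that give x a dominating color. *)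
Lemma sum_colorings (S : {set G}) x (phi : J -> nat) :
  loopless G -> x \notin S ->
  \sum_(f in colorings (x |: S)) phi (f x) =
  \sum_(g in colorings S) \sum_(c | compatible S g x c) phi c.
Proof.
move=> loG xS; rewrite pair_big_dep /=.
have Sx z : z \in S -> z == x = false by move=> zS; apply: contraNF xS => /eqP<-.
rewrite (reindex_onto (fun p : {ffun G -> J} * J => recolor p.1 x p.2)
                      (fun f => (recolor f x j0, f x))) /=; last first.
  by move=> f _; apply/ffunP=> z; rewrite !ffunE; case: eqP => [->|].
apply: eq_big => [[g c]|[g c] _] /=; last by rewrite ffunE eqxx.
rewrite xpair_eqE [recolor g x c x]ffunE eqxx eqxx andbT.
apply/andP/andP=> [[/coloringsP[fS f0] /eqP gE]|[/coloringsP[gS g0] gc]].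
  split.
    apply/coloringsP; split=> [u v uS vS uv|z zS].
      have := fS u v; rewrite !ffunE !Sx // !inE uS vS !orbT; exact.
    rewrite -gE !ffunE; case: eqP => // /eqP zx.
    by have := f0 z; rewrite ffunE (negPf zx) => -> //; rewrite !inE negb_or zx.
  apply/forall_inP=> z zS; apply/implyP=> xz.
  have := fS x z; rewrite !ffunE eqxx Sx // !inE eqxx zS orbT; exact.
split.
  apply/coloringsP; split=> [u v|z].
    rewrite !inE !ffunE => /predU1P[->|uS] /predU1P[->|vS].
    - by rewrite loG.
    - by rewrite eqxx Sx //; move/forall_inP/(_ v vS)/implyP: gc.
    - rewrite eqxx Sx // adj_sym [adj (g u) c]adj_sym.
      by move/forall_inP/(_ u uS)/implyP: gc.
    - by rewrite !Sx //; apply: gS.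
  by rewrite !inE negb_or ffunE => /andP[/negPf-> /g0].
by apply/eqP/ffunP=> z; rewrite !ffunE; case: eqP => // ->; rewrite g0.
Qed.

Lemma card_colorings_isolated (S : {set G}) x : loopless G -> x \notin S ->
  [set z in S | adj x z] = set0 ->
  #|colorings (x |: S)| = #|J| * #|colorings S|.
Proof.
move=> loG xS xN; rewrite -sum1_card (sum_colorings (fun=> 1) loG xS).
rewrite mulnC -sum_nat_const; apply: eq_bigr => g _; rewrite sum1_card.
apply: eq_card => c; apply/forall_inP=> z zS; apply/implyP=> xz.
by have := in_set0 z; rewrite -xN inE zS xz.
Qed.

End Colorings.

Lemma hom_complete (G J : graph) : (forall c d : J, adj c d) ->
  hom G J = #|J| ^ #|G|.
Proof.
move=> Jc; rewrite -card_ffun; apply: eq_card => f; rewrite inE.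
by apply/forallP=> x; apply/forallP=> y; rewrite Jc implybT.
Qed.

Definition dominating (J : graph) : {set J} := [set c | [forall d, adj c d]].

(** * The recursion for leaves and paths *)

Section Recursion.
(* a is the degree of the nondominating vertices; j0 and c0 witness that
   vertices of both kinds exist. *)
Variables (J : graph) (a : nat) (j0 c0 : J).
Hypothesis deg_nondominating : forall c : J, c \notin dominating J -> degree c = a.
Hypothesis j0_dominating : j0 \in dominating J.
Hypothesis c0_nondominating : c0 \notin dominating J.

Lemma dominatingP (c d : J) : c \in dominating J -> adj c d.
Proof. by rewrite inE => /forallP. Qed.

Lemma nondominating_degree_lt : a < #|J|.
Proof.
rewrite -(deg_nondominating c0_nondominating) -cardsT; apply: proper_card.
rewrite properEneq subsetT andbT; apply: contra c0_nondominating => /eqP NT.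
by rewrite inE; apply/forallP=> d; have := in_setT d; rewrite -NT inE.
Qed.

Lemma dominating_le : #|dominating J| <= a.
Proof.
rewrite -(deg_nondominating c0_nondominating); apply/subset_leq_card/subsetP=> c cB.
by rewrite inE adj_sym dominatingP.
Qed.

Lemma dominating_gt0 : 0 < #|dominating J|.
Proof. by apply/card_gt0P; exists j0. Qed.

Lemma degreeE (c : J) : degree c = a + (#|J| - a) * (c \in dominating J).
Proof.
have [cB|/deg_nondominating->] := boolP (c \in dominating J);
  last by rewrite muln0 addn0.
rewrite muln1 subnKC ?(ltnW nondominating_degree_lt) // -cardsT; apply: eq_card => d.
by rewrite !inE dominatingP.
Qed.

(** The degree of the color of y counts the colors left for x. By [degreeE] it
    is a plus, when that color is dominating, N - a; and the colorings in which
    y has a dominating color are counted by removing y in turn. *)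
Lemma card_colorings_leaf (G : graph) (S : {set G}) x y :
  loopless G -> x \notin S -> [set z in S | adj x z] = [set y] ->
  #|colorings j0 (x |: S)| = a * #|colorings j0 S|
    + (#|J| - a) * #|dominating J| * #|colorings j0 (S :\ y)|.
Proof.
move=> loG xS xN.
have xy z : z \in S -> adj x z = (z == y).
  by move=> zS; have := in_set1 z y; rewrite -xN inE zS.
have yS : y \in S by have := set11 y; rewrite -xN inE => /andP[].
rewrite -sum1_card (sum_colorings _ (fun=> 1) loG xS).
transitivity (\sum_(g in colorings j0 S) (a + (#|J| - a) * (g y \in dominating J))).
  apply: eq_bigr => g _; rewrite sum1_card -degreeE; apply: eq_card => c.
  rewrite [RHS]inE adj_sym; apply/forall_inP/idP => [/(_ y yS)|cy z zS].
    by rewrite xy // eqxx.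
  by rewrite xy //; apply/implyP=> /eqP->.
rewrite big_split /= sum_nat_const mulnC -big_distrr /= -mulnA; congr (_ + _ * _).
rewrite -{1}(setD1K yS).
rewrite (sum_colorings _ (fun c => (c \in dominating J) : nat) loG (negbT (setD11 y S))).
rewrite mulnC -sum_nat_const; apply: eq_bigr => g _.
rewrite -sum1_card [LHS]big_mkcond [RHS]big_mkcond; apply: eq_bigr => c _.
case: ifP => [|/negP gc]; first by case: (c \in _).
case: ifP => // cB; case: gc; apply/forall_inP=> z _.
by rewrite dominatingP // implybT.
Qed.

(** The recursion of [card_colorings_leaf], with the initial values of paths. *)
Fixpoint path_count n : nat :=
  if n is n1.+1 then
    if n1 is n2.+1 then
      a * path_count n1 + (#|J| - a) * #|dominating J| * path_count n2
    else #|J|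
  else 1.

Lemma path_count2 n : path_count n.+2 =
  a * path_count n.+1 + (#|J| - a) * #|dominating J| * path_count n.
Proof. by []. Qed.

Lemma path_count_gt0 n : 0 < path_count n.
Proof.
have a0 := leq_trans dominating_gt0 dominating_le.
elim: n => [//|[|n] IHn]; first exact: ltn_trans nondominating_degree_lt.
by rewrite path_count2 addn_gt0 muln_gt0 a0 IHn.
Qed.

Lemma dominating_path_count n : #|dominating J| * path_count n < path_count n.+1.
Proof.
case: n => [|n]; first by rewrite muln1 (leq_ltn_trans dominating_le nondominating_degree_lt).
rewrite path_count2 -addn1 leq_add ?leq_mul2r ?dominating_le ?orbT //.
by rewrite !muln_gt0 subn_gt0 nondominating_degree_lt dominating_gt0 path_count_gt0.
Qed.

(** The difference of the two sides is N - a times that in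
    [dominating_path_count]. *)
Lemma path_count_isolated n : path_count n.+2 < #|J| * path_count n.+1.
Proof.
rewrite path_count2 -{2}(subnKC (ltnW nondominating_degree_lt)) mulnDl ltn_add2l -mulnA.
by rewrite ltn_pmul2l ?subn_gt0 ?nondominating_degree_lt // dominating_path_count.
Qed.

Lemma card_colorings_line (G : graph) (s : seq G) : loopless G -> line s ->
  #|colorings j0 [set z in s]| = path_count (size s).
Proof.
move=> loG; move: {2}(size s).+1 (ltnSn (size s)) => n.
elim: n s => // n IHn [|x [|y s]] le_n ls.
- by rewrite /= -(card_colorings0 G j0);
    congr #|colorings _ _|; apply/setP=> z; rewrite !inE.
- rewrite set_cons card_colorings_isolated ?inE //.
    by rewrite /= -[RHS]muln1 -(card_colorings0 G j0); congr (_ * #|colorings _ _|).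
  by apply/setP=> z; rewrite !inE.
have [/= /andP[xs /andP[ys _]] _] := ls.
rewrite set_cons (card_colorings_leaf (y := y)) ?inE //; last first.
  by rewrite -(line_head ls); apply/setP=> z; rewrite !inE.
rewrite (IHn (y :: s) le_n (line_behead ls)).
have -> : [set z in y :: s] :\ y = [set z in s].
  by apply/setP=> z; rewrite !inE; have [->|] := eqVneq z y; rewrite ?(negPf ys).
by rewrite (IHn s (ltnW le_n) (line_behead (line_behead ls))).
Qed.

(** Induction on S by removing a leaf x, or an isolated vertex. In the leaf case
    the recursion is monotone in both terms, strictly because its coefficients
    are positive; so equality passes to S - x and S - x - y, and the line
    through S - x has the neighbor y of x at an end, where x prolongs it. *)
Theorem forest_lower_bound (G : graph) (S : {set G}) :
  loopless G -> acyclic G ->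
  path_count #|S| <= #|colorings j0 S| /\
  (#|colorings j0 S| = path_count #|S| ->
   exists2 s : seq G, line s & [set z in s] = S).
Proof.
move=> loG acG; move: {2}#|S|.+1 (ltnSn #|S|) => n.
elim: n S => // n IHn S le_n.
have [->|Sn0] := eqVneq S set0.
  by rewrite cards0 card_colorings0; split=> // _; exists [::].
have [x xS degx] := acyclic_leaf loG acG Sn0.
pose S' := S :\ x; have S'E : x |: S' = S by exact: setD1K.
have xS' : x \notin S' by rewrite setD11.
have cS : #|S| = #|S'|.+1 by rewrite -S'E cardsU1 xS'.
have ltS' : #|S'| < n by rewrite -ltnS -cS.
have [leS' eqS'] := IHn S' ltS'.
have NE : [set z in S' | adj x z] = [set z in S | adj x z].
  by apply/setP=> z; rewrite !inE; case: eqVneq => // ->; rewrite loG !andbF.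
move: degx; rewrite leq_eqVlt ltnS leqn0 cards_eq0 -NE.
case/orP=> [/cards1P[y xN]|/eqP xN].
  have yS' : y \in S' by have := set11 y; rewrite -xN inE => /andP[].
  have cS' : #|S'| = #|S' :\ y|.+1 by rewrite (cardsD1 y S') yS'.
  have [leS2 eqS2] := IHn (S' :\ y) (ltnW (leq_ltn_trans (eq_leq (esym cS')) ltS')).
  rewrite -S'E cardsU1 xS' add1n (card_colorings_leaf loG xS' xN) cS' path_count2 -cS'.
  have a0 : 0 < a := leq_trans dominating_gt0 dominating_le.
  have b0 : 0 < (#|J| - a) * #|dominating J|.
    by rewrite muln_gt0 subn_gt0 nondominating_degree_lt dominating_gt0.
  split; first by rewrite leq_add // leq_mul2l ?leS' ?leS2 orbT.
  move=> eqS; have /andP[/eqP e1 /eqP e2] :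
      (#|colorings j0 S'| == path_count #|S'|)
      && (#|colorings j0 (S' :\ y)| == path_count #|S' :\ y|).
    rewrite ![_ == path_count _]eqn_leq leS' leS2 !andbT.
    move/eqP: eqS; apply: contraTT; rewrite negb_and -!ltnNge => /orP[] lt;
      rewrite gtn_eqF //.
      by rewrite -addSn leq_add ?ltn_pmul2l // leq_mul2l leS2 orbT.
    by rewrite -addnS leq_add ?ltn_pmul2l // leq_mul2l leS' orbT.
  have [s ls sE] := eqS' e1; have [t lt tE] := eqS2 e2.
  have sS z : z \in s = (z \in S') by rewrite -sE inE.
  have xl : {in s, forall z, adj x z = (z == y)}.
    by move=> z; rewrite sS => zS; have := in_set1 z y; rewrite -xN inE zS.
  have prolong r : line r -> r =i s -> (exists r', r = y :: r') ->
      exists2 s : seq G, line s & [set z in s] = x |: S'.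
    move=> lr rs [r' rE]; rewrite {}rE in lr rs; exists [:: x, y & r'].
      apply: line_cons => //; first by rewrite rs sS.
      by move=> z; rewrite rs; apply: xl.
    by rewrite set_cons; congr (_ |: _); apply/setP=> z; rewrite inE rs sS.
  have ys : y \in s by rewrite sS.
  have ts : t =i [predD1 s & y].
    by move=> z; rewrite [RHS]inE /= sS -in_setD1 -tE inE.
  case: (line_delete_end ls lt ys ts) => [y0|yl].
    apply: (prolong s) => //; case: (s) ys y0 => // z s' _ /=.
    by case: eqP => // -> _; exists s'.
  apply: (prolong (rev s)); first exact: line_rev.
    by move=> z; rewrite mem_rev.
  have [us _] := ls; case: (lastP s) us ys yl => // s' z.
  rewrite rcons_uniq => /andP[zs' _]; rewrite mem_rcons => _.
  rewrite size_rcons rev_rcons -cats1 index_cat => -[].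
  have [ys' ei|_] := boolP (y \in s'); first by move: ys'; rewrite -index_mem ei ltnn.
  by rewrite /=; case: eqP => [-> _|_]; [exists (rev s') | rewrite addn1 => -[/esym/n_Sn]].
rewrite -S'E cardsU1 xS' (card_colorings_isolated _ loG xS' xN) add1n.
case E : #|S'| leS' => [|m] leS'.
  rewrite (cards0_eq E) card_colorings0 muln1; split=> // _; exists [:: x].
    exact: line1.
  by apply/setP=> z; rewrite !inE orbF.
have lt : path_count m.+2 < #|J| * #|colorings j0 S'|.
  by apply: leq_trans (path_count_isolated m) _; rewrite leq_mul2l leS' orbT.
by split; [exact: ltnW | move=> eqS; rewrite eqS ltnn in lt].
Qed.
End Recursion.

(** * The join of a regular graph with a looped complete graph *)

Lemma degree_looped_join (H : graph) l (u : H) :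
  degree (inl u : looped_join H l) = degree u + l.
Proof.
rewrite /degree -sum1_card big_sumType /=; congr (_ + _).
  by rewrite -sum1_card; apply: eq_bigl => w; rewrite !inE.
by rewrite -[RHS]card_ord -sum1_card; apply: eq_bigl => w; rewrite !inE.
Qed.

Lemma looped_join_dominating (H : graph) l (i : 'I_l) :
  (inr i : looped_join H l) \in dominating (looped_join H l).
Proof. by rewrite inE; apply/forallP=> -[]. Qed.

Theorem theorem1p2 (n : nat) (H : graph) (l : nat) (T : graph) :
  1 <= n -> regular H -> 1 <= l -> is_tree T -> #|T| = n ->
  hom (path_graph n) (looped_join H l) <= hom T (looped_join H l) /\
  (hom (path_graph n) (looped_join H l) = hom T (looped_join H l) <->
   graph_iso T (path_graph n) \/
   exists2 q : nat, l <= q & graph_iso (looped_join H l) (looped_complete q)).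
Proof.
move=> _ [d Hd] l1 [loT _ acT] cT; set J := looped_join H l.
have loP : loopless (path_graph n).
  by move=> i; rewrite /= /path_adj orbb gtn_eqF.
have cP : #|path_graph n| = n by exact: card_ord.
have [Jc|] := boolP [forall c : J, c \in dominating J].
  have {}Jc (c d0 : J) : adj c d0 by apply: dominatingP; apply: (forallP Jc).
  rewrite !hom_complete // cP cT; split=> //; split=> // _; right.
  exists #|J|; first by rewrite card_sum card_ord leq_addl.
  by exists (@enum_rank J); [exact: enum_rank_bij | move=> x y; rewrite Jc].
rewrite negb_forall => /existsP[c0 c0N].
have degN (c : J) : c \notin dominating J -> degree c = d + l.
  by case: c => [u _|i]; rewrite ?looped_join_dominating // degree_looped_join Hd.
pose j0 : J := inr (Ordinal l1).
have j0B : j0 \in dominating J by exact: looped_join_dominating.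
have lineE (G : graph) (s : seq G) : loopless G -> line s ->
    [set z in s] = [set: G] -> hom G J = path_count J (d + l) #|G|.
  move=> loG ls sT; rewrite (hom_colorings _ j0) -sT.
  rewrite (card_colorings_line _ degN c0N loG ls) -cardsT -sT cardsE.
  by case: ls => us _; rewrite (card_uniqP us).
have homP : hom (path_graph n) J = path_count J (d + l) n.
  rewrite (lineE _ _ loP (path_graph_line n)) ?cP //.
  by apply/setP=> i; rewrite !inE mem_enum.
have [leT eqT] := forest_lower_bound degN j0B c0N [set: T] loT acT.
move: leT eqT; rewrite -hom_colorings cardsT cT homP => leT eqT; split=> //.
split=> [/esym/eqT[s ls sT]|[/iso_path_line[s ls sT]|[q _ [f _ fadj]]]].
- by left; rewrite -cT; apply: line_path_iso sT.
- by rewrite (lineE _ _ loT ls sT) cT.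
by case/negP: c0N; rewrite inE; apply/forallP=> c; rewrite -fadj.
Qed.
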